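(* Let $(K,d)$ be a complete metric space and let $Y$ be a Banach space. Let $(Z,\|\cdot\|_Z)$ be a Banach space included in $C_b(K,Y)$ such that $\|\cdot\|_Z\ge\|\cdot\|_\infty$ on $Z$, and such that for all $x_1,x_2\in K$ and $y_1^*,y_2^*\in S_{Y^*}$, $$y_1^*\circ\delta_{x_1}=y_2^*\circ\delta_{x_2}\ \text{on } Z\ \Longrightarrow\ x_1=x_2\ \text{and}\ y_1^*=y_2^*.$$ Suppose that $(C_K,\gamma_{\mathcal{P}})$ is a complete pseudometric space having the weak$^*$-uniform separation property in $Z^*$, where $C_K=\{y^*\circ\delta_x: x\in K,\ y^*\in S_{Y^*}\}\subset Z^*$ and $\gamma_{\mathcal{P}}(y^*\circ\delta_x,z^*\circ\delta_{x'})=d(x,x')$. Then for every $h\in C_b(K,Y)$, the set $$\mathcal{N}(h):=\{g\in Z:\ h+g \text{ does not attain strongly its sup-norm}\}$$ is a $\sigma$-porous subset of $(Z,\|\cdot\|_Z)$. Moreover, for every $\varepsilon>0$ there exists $\lambda(\varepsilon)>0$ such that for every $f\in Z$ with $\|f\|_\infty=1$ and every $x\in K$ satisfying $\|f(x)\|>1-\lambda(\varepsilon)$, there exist $k\in Z$ with $\|k\|_\infty=1$ and $\overline{x}\in K$ such that (i) the function $z\mapsto\|k(z)\|$ attains strongly its maximum on $K$ at $\overline{x}$; (ii) $d(\overline{x},x)<\varepsilon$ and $\|f-k\|_\infty<\varepsilon$.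
   Context: Banach spaces are real. $C_b(K,Y)$ is the Banach space of all $Y$-valued bounded continuous functions on $K$ with the sup-norm $\|\cdot\|_\infty$. $S_{Y^*}$ is the unit sphere of $Y^*$. For $(x,y^* )\in K\times S_{Y^*}$, $y^*\circ\delta_x$ denotes the functional $T\mapsto\langle y^*,T(x)\rangle$; since $\|\cdot\|_Z\ge\|\cdot\|_\infty$, its restriction to $Z$ belongs to $Z^*$. A function $T\in C_b(K,Y)$ attains strongly its sup-norm if $z\mapsto\|T(z)\|$ attains strongly its maximum on $K$ at some $x_0\in K$, i.e. $\|T(x_0)\|=\|T\|_\infty$ and for every sequence $(x_n)\subset K$, $\|T(x_n)\|\to\|T\|_\infty$ implies $d(x_n,x_0)\to0$. Pseudometric: for a nonempty set $C$, a map $\gamma:C\times C\to[0,\infty)$ with $\gamma(p,p)=0$, $\gamma(p,q)=\gamma(q,p)$ and $\gamma(p,q)\le\gamma(p,r)+\gamma(r,q)$. Put $p\sim q$ iff $\gamma(p,q)=0$; $(C,\gamma)$ is complete if the quotient $C/\!\sim$ with the induced metric is a complete metric space. Weak$^*$-uniform separation property: for $C\subset Z^*$, a pseudometric space $(C,\gamma)$ has this property in $Z^*$ if there exists $a>0$ such that for every $\varepsilon\in\,]0,a]$ there exists $\varpi_C(\varepsilon)>0$ such that for every $p\in C$ there exists $T_{p,\varepsilon}$ in the closed unit ball of $Z$ with $$\langle p,T_{p,\varepsilon}\rangle-\varpi_C(\varepsilon)\ge\langle q,T_{p,\varepsilon}\rangle\quad\text{for all } q\in C \text{ with } \gamma(q,p)\ge\varepsilon.$$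 $\sigma$-porosity: a subset $A$ of a metric space $M$ is porous in $M$ if there exist $\lambda_0\in(0,1]$ and $r_0>0$ such that for any $x\in M$ and $r\in(0,r_0]$ there exists $y\in M$ such that $\mathring{B}(y;\lambda_0 r)\subset\mathring{B}(x;r)\cap(M\setminus A)$, where $\mathring{B}(\cdot\,;\cdot)$ denotes open balls of $M$. $A$ is $\sigma$-porous if it is a countable union of porous sets in $M$. *)

(* Defs.v *)
From mathcomp Require Import all_boot all_order all_algebra.
From mathcomp Require Import boolp classical_sets functions reals.
From mathcomp Require Import topology normedtype sequences.

Set Implicit Arguments.
Unset Strict Implicit.
Unset Printing Implicit Defensive.

Import Order.TTheory GRing.Theory Num.Theory.
Import numFieldNormedType.Exports.

Local Open Scope classical_set_scope.
Local Open Scope ring_scope.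

Section PseudometricSpaces.
Context {R : realType} {T : Type}.
Implicit Types (C : set T) (gamma : T -> T -> R).

Definition complete_for C gamma :=
  forall u : nat -> T, (forall n, C (u n)) ->
    (forall e : R, 0 < e -> exists N : nat, forall m n : nat,
       (N <= m)%N -> (N <= n)%N -> gamma (u m) (u n) < e) ->
  exists2 l, C l & gamma (u n) l @[n --> \oo] --> (0 : R).

Definition pseudometric_on C gamma :=
  [/\ C !=set0,
      forall p q, C p -> C q -> 0 <= gamma p q,
      forall p, C p -> gamma p p = 0,
      forall p q, C p -> C q -> gamma p q = gamma q p &
      forall p q r, C p -> C q -> C r ->
        gamma p q <= gamma p r + gamma r q].

Definition pclass C gamma (p : T) : set T := [set q | C q /\ gamma p q = 0].

Definition pquotient C gamma : set (set T) := [set pclass C gamma p | p in C].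

(* When [A] and [B] are classes of a pseudometric, [gamma p q] takes a single
   value for [p] in [A] and [q] in [B]; [get] extracts it. *)
Definition pquotient_dist gamma (A B : set T) : R :=
  get [set gamma p q | p in A & q in B].

End PseudometricSpaces.

Definition complete_pseudometric_on {R : realType} {T : Type} (C : set T)
    (gamma : T -> T -> R) :=
  pseudometric_on C gamma /\
  complete_for (pquotient C gamma) (pquotient_dist gamma).

(* The axiom of [completeType], which would also require a chosen point. *)
Definition complete_metric {R : realType} (K : metricType R) :=
  forall F : set_system K, ProperFilter F -> cauchy F -> exists l : K, F --> l.

(* [normedModType] does not inherit from [metricType]; its [ball] is the open norm
   ball. *)
Section Porosity.
Context {R : realType} {M : pseudoMetricType R}.

Definition porous (A : set M) :=
  exists l0 r0 : R, [/\ 0 < l0, l0 <= 1, 0 < r0 &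
    forall (x : M) (r : R), 0 < r -> r <= r0 ->
      exists y : M, ball y (l0 * r) `<=` ball x r `&` ~` A].

Definition sigma_porous (A : set M) :=
  exists2 P : nat -> set M, (forall n, porous (P n)) & A = \bigcup_n P n.

End Porosity.

Section Dual.
Context {R : realType} {V : normedModType R}.

(* The topological dual, as a set of functions, so that equality of
   functionals is equality of functions. *)
Definition dual_space : set (V -> R) :=
  [set p | linear (p : V -> R^o) /\ continuous p].

Definition dual_norm (p : V -> R) : R :=
  sup [set `|p v| | v in [set v : V | `|v| <= 1]].

Definition dual_sphere : set (V -> R) := [set p | dual_space p /\ dual_norm p = 1].

Definition weakstar_uniform_separation (C : set (V -> R))
    (gamma : (V -> R) -> (V -> R) -> R) :=
  exists2 a : R, 0 < a & forall e : R, 0 < e -> e <= a ->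
    exists2 w : R, 0 < w & forall p, C p ->
      exists2 t : V, `|t| <= 1 &
        forall q, C q -> e <= gamma q p -> q t <= p t - w.

End Dual.
Arguments dual_space {R} V.
Arguments dual_sphere {R} V.

Section BoundedContinuous.
Context {R : realType} {K : metricType R} {Y : normedModType R}.

Definition Cb : set (K -> Y) := [set f | continuous f /\ bounded_fun f].

Definition sup_norm (f : K -> Y) : R := sup (range (fun x => `|f x|)).

Definition strongly_attains_at (f : K -> Y) (x0 : K) :=
  `|f x0| = sup_norm f /\
  forall u : nat -> K, `|f (u n)| @[n --> \oo] --> sup_norm f ->
    mdist (u n) x0 @[n --> \oo] --> (0 : R).

Definition strongly_attains (f : K -> Y) :=
  exists x0, strongly_attains_at f x0.

End BoundedContinuous.

(* A space [Z] of functions from [K] to [Y] is given by a linear map [J] sending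
   an element of [Z] to the function that it is. *)
Section FunctionSpace.
Context {R : realType} {K : metricType R} {Y Z : normedModType R}.
Variable J : Z -> (K -> Y).

Definition eval_functional (ys : Y -> R) (x : K) : Z -> R :=
  fun g => ys (J g x).

Definition eval_functionals : set (Z -> R) :=
  [set p | exists x ys, dual_sphere Y ys /\ p = eval_functional ys x].

Definition not_strongly_attaining (h : K -> Y) : set Z :=
  [set g | ~ strongly_attains (h + J g)].

End FunctionSpace.

(* Main.v *)
Require Import Defs.
From mathcomp Require Import all_boot all_order all_algebra.
From mathcomp Require Import boolp classical_sets functions reals.
From mathcomp Require Import topology normedtype sequences.
From mathcomp Require Import lra.

Import Order.TTheory GRing.Theory Num.Theory.
Import numFieldNormedType.Exports.

Local Open Scope classical_set_scope.
Local Open Scope ring_scope.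

(** The proof rests on one perturbation.  Call [f] peaked at [x] with radius [e]
    when all points where [|f|] is close to its supremum lie within [e] of [x].
    Given [f] and a point [x] where [|f x|] is nearly maximal, choose [ys] in the
    dual sphere with [ys (f x) = |f x|].  The separation property at the
    functional [ys] evaluated at [x] provides [t] in the unit ball of [Z] whose
    norm at every point far from [x] is at most [ys (J t x) - w].  Adding [s *: t]
    to [f] raises the norm at [x] by at least [s * ys (J t x)] and the norm far
    from [x] by at most [s * (ys (J t x) - w)], which creates a gap proportional
    to [s * w].  The gap survives every further perturbation of size
    [s * w / 8], because the norm of [Z] dominates the sup-norm
    ([peak_bump]).

    Since the size [s] of the perturbation and the size [s * w / 8] of the
    ball on which it works are proportional, with a ratio depending only on [e],
    the [g] for which [h + J g] has no peak of radius [e] form a porous set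
    ([no_peak_porous]).  A bounded continuous function on a complete space which
    has peaks of all radii attains strongly its sup-norm: the sets where it is
    nearly maximal form a Cauchy filter, whose limit is the maximum point
    ([strongly_attains_of_peaks]).  Taking the radii [1 / (n + 1)] yields
    sigma-porosity.

    For the quantitative statement, perturb [f] by a bump so that it gets a peak
    at [x] that is stable in a whole ball of [Z].  By Baire's theorem a
    sigma-porous set has dense complement ([sigma_porous_dense]), so this ball
    contains [u] with [J u] strongly attaining its sup-norm; its maximum point is
    near [x] because of the peak, and dividing [u] by its sup-norm, which is
    close to [1], gives [k].

    The norm of a vector of [Y] is the maximum of the values there of the
    functionals of the dual sphere.  This consequence of the Hahn-Banach theorem
    ([dual_sphere_norming]) is obtained from minimal sublinear functionals, which
    are linear, rather than by extending functionals from subspaces. *)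

(** * Linear functionals below a sublinear one *)

Section Sublinear.
Context {R : realType} {V : lmodType R}.
Implicit Types q p : V -> R.

Definition sublinear q :=
  (forall u v, q (u + v) <= q u + q v) /\
  (forall a v, 0 < a -> q (a *: v) <= a * q v).

Lemma sublinearZ q a v : sublinear q -> 0 < a -> q (a *: v) = a * q v.
Proof.
move=> [_ qZ] a0; apply/eqP; rewrite eq_le qZ//= -ler_pdivlMl//.
by rewrite -[in X in X <= _](@scalerK _ _ a _ v) ?gt_eqF// qZ ?invr_gt0.
Qed.

Lemma sublinear0 q : sublinear q -> q 0 = 0.
Proof.
by move=> qS; have := sublinearZ q 2 0 qS (ltr0Sn R 1); rewrite scaler0; lra.
Qed.

Lemma sublinearN q v : sublinear q -> - q (- v) <= q v.
Proof.
move=> qS; have [qD _] := qS; have := qD v (- v).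
by rewrite subrr sublinear0//; lra.
Qed.

(** The pointwise infimum of a family of functions is sublinear as soon as sums
    and dilations can be bounded by some other member of the family.  This covers
    both infima of chains of sublinear functions and [odd_along], where the
    individual members are not sublinear. *)
Lemma sublinear_inf {I : Type} (D : set I) (f : I -> V -> R) :
  D !=set0 -> (forall v, has_lbound [set f i v | i in D]) ->
  (forall i j u v, D i -> D j ->
     exists2 k, D k & f k (u + v) <= f i u + f j v) ->
  (forall i a v, D i -> 0 < a -> exists2 k, D k & f k (a *: v) <= a * f i v) ->
  sublinear (fun v => inf [set f i v | i in D]).
Proof.
move=> [i0 Di0] lbf fD fZ.
have fne v : [set f i v | i in D] !=set0 by exists (f i0 v); exists i0.
have inf_le i v : D i -> inf [set f i v | i in D] <= f i v.
  by move=> Di; apply: ge_inf => //; exists i.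
split=> [u v|a v a0].
  rewrite -lerBlDr; apply: lb_le_inf => // _ [i Di <-].
  rewrite lerBlDl -lerBlDr; apply: lb_le_inf => // _ [j Dj <-].
  have [k Dk fk] := fD i j u v Di Dj.
  by rewrite lerBlDl (le_trans (inf_le k _ Dk)).
rewrite -ler_pdivrMl//; apply: lb_le_inf => // _ [i Di <-].
have [k Dk fk] := fZ i a v Di a0.
by rewrite ler_pdivrMl// (le_trans (inf_le k _ Dk)).
Qed.

(** For sublinear [q], the largest sublinear function below [q] that maps [- x]
    to at most [- q x]; a linear function below it thus agrees with [q] at [x]. *)
Definition odd_along (x : V) q : V -> R :=
  fun v => inf [set q (v + t *: x) - t * q x | t in [set t : R | 0 <= t]].

Lemma odd_along_lbound x q v : sublinear q ->
  has_lbound [set q (v + t *: x) - t * q x | t in [set t : R | 0 <= t]].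
Proof.
move=> qS; exists (- q (- v)) => _ [t /= t0 <-].
have -> : t * q x = q (t *: x).
  have [->|tn0] := eqVneq t 0; first by rewrite mul0r scale0r sublinear0.
  by rewrite sublinearZ// lt_neqAle eq_sym tn0.
by have := qS.1 (v + t *: x) (- v); rewrite addrAC subrr add0r; lra.
Qed.

Lemma odd_along_sublinear x q : sublinear q -> sublinear (odd_along x q).
Proof.
move=> qS; apply: (sublinear_inf [set t : R | 0 <= t]
  (fun t v => q (v + t *: x) - t * q x)).
- by exists 0 => /=.
- by move=> v; exact: odd_along_lbound.
- move=> s t u v /= s0 t0; exists (s + t) => /=; first exact: addr_ge0.
  have := qS.1 (u + s *: x) (v + t *: x).
  by rewrite addrACA -scalerDl mulrDl; lra.
- move=> t a v /= t0 a0; exists (a * t) => /=; first by rewrite mulr_ge0// ltW.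
  by rewrite -scalerA -scalerDr sublinearZ// mulrBr mulrA.
Qed.

Lemma odd_along_le x q v : sublinear q -> odd_along x q v <= q v.
Proof.
move=> qS; apply: ge_inf; first exact: odd_along_lbound.
by exists 0 => //=; rewrite scale0r addr0 mul0r subr0.
Qed.

Lemma odd_alongN x q : sublinear q -> odd_along x q (- x) <= - q x.
Proof.
move=> qS; apply: ge_inf; first exact: odd_along_lbound.
by exists 1 => //=; rewrite scale1r addNr sublinear0// mul1r add0r.
Qed.

(** By minimality [odd_along v q = q] for every [v], so that [q] is odd, and
    subadditivity at [u], [v] and at their opposites makes [q] additive. *)
Lemma minimal_sublinear_linear q : sublinear q ->
  (forall p, sublinear p -> (forall v, p v <= q v) -> p = q) ->
  linear (q : V -> R^o).
Proof.
move=> qS qmin.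
have qN v : q (- v) = - q v.
  apply/eqP; rewrite eq_le; apply/andP; split; last first.
    by have := sublinearN q v qS; lra.
  have qv : odd_along v q = q.
    by apply: qmin => [|u]; [exact: odd_along_sublinear|exact: odd_along_le].
  by have := odd_alongN v q qS; rewrite qv.
have qD u v : q (u + v) = q u + q v.
  apply/eqP; rewrite eq_le qS.1/=.
  by have := qS.1 (- u) (- v); rewrite -opprD !qN; lra.
move=> a u v; rewrite qD; congr (_ + _).
have [a0|a0|->] := ltgtP a 0; last by rewrite !scale0r sublinear0.
- by rewrite -[a]opprK scaleNr qN sublinearZ ?oppr_gt0// scaleNr.
- exact: sublinearZ.
Qed.

(** Zorn's lemma applies because sublinear functions below [q0] are bounded below
    by [- q0 (- v)], so that chains have sublinear pointwise infima. *)
Lemma minimal_sublinear q0 : sublinear q0 ->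
  exists q, [/\ sublinear q, forall v, q v <= q0 v &
    forall p, sublinear p -> (forall v, p v <= q v) -> p = q].
Proof.
move=> q0S; pose T := {q | sublinear q /\ forall v, q v <= q0 v}.
pose r (s t : T) := `[< forall v, sval t v <= sval s v >].
have [|||A Atot|[q [qS qq0]] qmin] := @Zorn T r.
- by move=> t; apply/asboolP.
- move=> s t u /asboolP st /asboolP tu; apply/asboolP => v.
  exact: le_trans (tu v) (st v).
- move=> [s ?] [t ?] /asboolP/= st /asboolP/= ts; apply: eq_exist.
  apply/funext => v.
  by apply/eqP; rewrite eq_le st ts.
- have [[t0 At0]|A0] := pselect (A !=set0); last first.
    exists (exist _ q0 (conj q0S (fun v => lexx (q0 v)))) => s As.
    by exfalso; apply: A0; exists s.
  have lbA v : has_lbound [set sval t v | t in A].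
    exists (- q0 (- v)) => _ [[t [tS tq0]] At <-] /=.
    by have := sublinearN t v tS; have := tq0 (- v); lra.
  pose m v := inf [set sval t v | t in A].
  have mle t v : A t -> m v <= sval t v.
    by move=> At; apply: ge_inf => //; exists t.
  have mS : sublinear m.
    apply: (sublinear_inf A (fun t => sval t)) => //; first by exists t0.
      move=> s t u v As At.
      have [/asboolP st|/asboolP ts] := Atot s t As At.
        by exists t => //; have := (svalP t).1.1 u v; have := st u; lra.
      by exists s => //; have := (svalP s).1.1 u v; have := ts v; lra.
    by move=> t a v At a0; exists t => //; exact: (svalP t).1.2.
  have mq0 v : m v <= q0 v.
    exact: le_trans (mle _ _ At0) ((svalP t0).2 v).
  exists (exist _ m (conj mS mq0)) => s As; apply/asboolP => v /=.
  exact: mle.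
- exists q; split => // p pS pq.
  have pq0 v : p v <= q0 v by exact: le_trans (pq v) (qq0 v).
  suff /qmin/(congr1 sval) :
    r (exist _ q (conj qS qq0)) (exist _ p (conj pS pq0)) by [].
  exact/asboolP.
Qed.

(** A minimal sublinear function below [odd_along y q] maps [- y] to at most
    [- q y]; being linear, it reaches [q y] at [y]. *)
Lemma norming_linear q y : sublinear q ->
  exists p, [/\ linear (p : V -> R^o), forall v, p v <= q v & p y = q y].
Proof.
move=> qS.
have [p [pS pq pmin]] := minimal_sublinear _ (odd_along_sublinear y q qS).
have plin := minimal_sublinear_linear p pS pmin.
exists p; split=> // [v|].
  exact: le_trans (pq v) (odd_along_le y q v qS).
apply/eqP; rewrite eq_le (le_trans (pq y) (odd_along_le y q y qS))/=.
have := le_trans (pq (- y)) (odd_alongN y q qS).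
by have := sublinearN p y pS; lra.
Qed.

End Sublinear.

(** * Norming functionals *)

Section NormingFunctionals.
Context {R : realType} {Y : normedModType R}.

Lemma norm_sublinear : sublinear (fun v : Y => `|v|).
Proof.
by split=> [u v|a v a0]; [exact: ler_normD|rewrite normrZ gtr0_norm].
Qed.

Lemma dual_sphere_le (p : Y -> R) y : dual_sphere Y p -> p y <= `|y|.
Proof.
move=> [[plin _] p1].
have pZ a v : p (a *: v) = a * p v := scalable_linear plin a v.
have supP : has_sup [set `|p v| | v in [set v : Y | `|v| <= 1]].
  (* Otherwise the supremum would take its default value 0. *)
  apply: contrapT => /sup_out; move: p1; rewrite /dual_norm => -> /eqP.
  by rewrite oner_eq0.
have [->|y0] := eqVneq y 0.
  by rewrite -(scale0r 0) pZ mul0r normr_ge0.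
have ny : 0 < `|y| by rewrite normr_gt0.
rewrite -[leRHS]mulr1 -ler_pdivrMl// -pZ.
apply: le_trans (ler_norm _) _; rewrite -p1.
apply: ub_le_sup; first by case: supP.
exists (`|y|^-1 *: y) => //=.
by rewrite normrZ normfV normr_id mulVf// gt_eqF.
Qed.

(** For [y = 0] any element of the sphere does, which is why the sphere has to be
    assumed nonempty: it is empty when [Y] is trivial. *)
Lemma dual_sphere_norming (y : Y) : dual_sphere Y !=set0 ->
  exists2 p, dual_sphere Y p & p y = `|y|.
Proof.
have [->|y0] := eqVneq y 0 => [[p pS]|_].
  exists p => //; have [[plin _] _] := pS.
  have pZ v : p (0 *: v) = 0 * p v := scalable_linear plin 0 v.
  by rewrite normr0 -[X in p X](scale0r 0) pZ mul0r.
have [p [plin ple py]] := norming_linear _ y norm_sublinear.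
exists p => //.
have pZ a v : p (a *: v) = a * p v := scalable_linear plin a v.
have pB u v : p (u - v) = p u - p v := zmod_morphism_linear plin u v.
have pN v : p (- v) = - p v by rewrite -scaleN1r pZ mulN1r.
have pabs v : `|p v| <= `|v|.
  by rewrite ler_norml ple andbT; have := ple (- v); rewrite pN normrN; lra.
split; first split=> //.
  move=> v; apply/cvgrPdist_lt => e e0.
  apply: filterS (nbhsx_ballx v e e0) => w; rewrite -ball_normE/= -pB.
  exact: le_lt_trans.
have ub1 : ubound [set `|p v| | v in [set v : Y | `|v| <= 1]] 1.
  by move=> _ [v /= v1 <-]; exact: le_trans (pabs v) v1.
apply/eqP; rewrite eq_le; apply/andP; split.
  by apply: ge_sup => //; exists `|p 0|; exists 0 => //=; rewrite normr0.
apply: ub_le_sup; first by exists 1.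
exists (`|y|^-1 *: y) => /=.
  by rewrite normrZ normfV normr_id mulVf ?normr_eq0.
by rewrite pZ py mulVf ?normr_eq0// normr1.
Qed.

End NormingFunctionals.

(** * Peaks and strong maxima *)

Section SupNorm.
Context {R : realType} {K : metricType R} {Y : normedModType R}.
Implicit Types f : K -> Y.

Lemma norm_le_sup_norm f x : bounded_fun f -> `|f x| <= sup_norm f.
Proof.
move=> [M [_ fM]]; apply: ub_le_sup; last by exists x.
by exists (M + 1) => _ [z _ <-]; apply: fM => //; rewrite ltrDl.
Qed.

Lemma sup_norm_le (x0 : K) f M : (forall x, `|f x| <= M) -> sup_norm f <= M.
Proof.
move=> fM; apply: ge_sup; first by exists `|f x0|; exists x0.
by move=> _ [x _ <-].
Qed.

Lemma near_sup_norm (x0 : K) f d : bounded_fun f -> 0 < d ->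
  exists x, sup_norm f - d < `|f x|.
Proof.
move=> [M [_ fM]] d0.
have [|_ [x _ <-] fx] := @sup_adherent _ (range (fun x => `|f x|)) _ d0.
  split; first by exists `|f x0|; exists x0.
  by exists (M + 1) => _ [z _ <-]; apply: fM => //; rewrite ltrDl.
by exists x.
Qed.

Lemma bounded_funZ f (a : R) : bounded_fun f -> bounded_fun (a *: f).
Proof.
move=> fb; exists (`|a| * sup_norm f); split; first exact: num_real.
move=> M aM x _ /=.
rewrite [X in X <= _]normrZ (le_trans _ (ltW aM))// ler_wpM2l//.
exact: norm_le_sup_norm.
Qed.

Lemma sup_normZ (x0 : K) f (a : R) : bounded_fun f ->
  0 < a -> sup_norm (a *: f) = a * sup_norm f.
Proof.
move=> fb a0; apply/eqP; rewrite eq_le; apply/andP; split.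
  apply: (sup_norm_le x0) => x.
  by rewrite [X in X <= _]normrZ gtr0_norm// ler_pM2l// norm_le_sup_norm.
rewrite -ler_pdivlMl//; apply: (sup_norm_le x0) => x.
rewrite ler_pdivlMl//.
have := norm_le_sup_norm (a *: f) x (bounded_funZ f a fb).
by rewrite [X in X <= _]normrZ gtr0_norm.
Qed.

Lemma strongly_attains_atZ f (a : R) x : bounded_fun f -> 0 < a ->
  strongly_attains_at f x -> strongly_attains_at (a *: f) x.
Proof.
move=> fb a0 [fx fu].
have normZ z : `|(a *: f) z| = a * `|f z|.
  by rewrite [LHS]normrZ gtr0_norm.
split=> [|u]; rewrite (sup_normZ x)//; first by rewrite normZ fx.
move=> au; apply: fu.
rewrite -[sup_norm f](mulKf (lt0r_neq0 a0)).
have -> : (fun n => `|f (u n)|) = (fun n => a^-1 * `|(a *: f) (u n)|).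
  by apply/funext => n; rewrite normZ mulKf ?gt_eqF.
exact: cvgMr.
Qed.

(** Having a peak of radius [e] somewhere is stable under small uniform
    perturbations; for [f] in [Cb] over a complete space, having peaks of all
    radii amounts to attaining strongly the sup-norm. *)
Definition peak f (e : R) (x : K) :=
  exists2 d, 0 < d & forall z, sup_norm f - d < `|f z| -> mdist z x < e.

Lemma strongly_attains_peak f e x xmax :
  peak f e x -> strongly_attains_at f xmax -> mdist xmax x < e.
Proof.
by move=> [d d0 fd] [fx _]; apply: fd; rewrite fx ltrBlDr ltrDl.
Qed.

(** The sets [top d] where [|f|] exceeds its supremum minus [d] generate a filter,
    which the peaks make Cauchy.  Continuity forces [|f|] to be maximal at the
    limit, and a maximizing sequence is finer than the filter. *)
Lemma strongly_attains_of_peaks f : complete_metric K -> Cb f ->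
  (forall n : nat, exists x, peak f n.+1%:R^-1 x) -> strongly_attains f.
Proof.
move=> Kc [fc fb] fpk.
have [x0 _] := fpk 0%N.
pose top d := [set x | sup_norm f - d < `|f x|].
pose F := filter_from [set d : R | 0 < d] top.
have FF : ProperFilter F.
  apply: filter_from_proper; last by move=> d; exact: near_sup_norm.
  apply: filter_from_filter; first by exists 1 => /=.
  move=> d1 d2 /= d10 d20; exists (Num.min d1 d2); first by rewrite /= lt_min d10.
  move=> x; rewrite /top/= => fx.
  have [m1 m2] : Num.min d1 d2 <= d1 /\ Num.min d1 d2 <= d2.
    by rewrite !ge_min !lexx orbT.
  by split; lra.
have Ftop d : 0 < d -> F (top d) by move=> d0; exists d.
have [l Fl] : exists l : K, F --> l.
  apply: Kc; apply: cauchy_exP => e e0.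
  have [n ne] : exists n : nat, n.+1%:R^-1 < e.
    by have [n] := ltr_add_invr e0; rewrite add0r; exists n.
  have [x [d d0 fd]] := fpk n.
  exists x, d => // z fz; rewrite ballEmdist/= metric_sym.
  exact: lt_trans (fd _ fz) ne.
exists l.
have Ffl : `|f x| @[x --> F] --> `|f l|.
  apply: cvg_norm; apply: cvg_trans (fc l); exact: cvg_app.
have Ffs : `|f x| @[x --> F] --> sup_norm f.
  apply/cvgrPdist_lt => e e0; exists e => // x fx.
  by rewrite ger0_norm ?subr_ge0 ?norm_le_sup_norm// ltrBlDr -ltrBlDl.
split; first exact: (cvg_unique _ Ffl Ffs).
move=> u us.
have ul : u @ \oo --> l.
  move=> A /Fl[d d0 topA].
  have := us; move=> /cvgrPdist_lt/(_ d d0); apply: filterS => n un.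
  by apply: topA; rewrite /top/=; move: un; rewrite ltr_norml; lra.
apply/cvgrPdist_lt => e e0.
have : \forall n \near \oo, ball l e (u n) := ul _ (nbhsx_ballx l e e0).
apply: filterS => n; rewrite ballEmdist/=.
by rewrite sub0r normrN ger0_norm ?mdist_ge0// metric_sym.
Qed.

End SupNorm.

(** * Porous sets and category *)

Section PorousSets.
Context {R : realType}.

Lemma porousS {M : pseudoMetricType R} (A B : set M) :
  A `<=` B -> porous B -> porous A.
Proof.
move=> AB [l0 [r0 [l00 l01 r00 Bp]]]; exists l0, r0; split=> // x r r_gt0 rr0.
have [y yB] := Bp x r r_gt0 rr0; exists y => z /yB[xz nBz].
by split=> // /AB.
Qed.

Lemma porous_nowhere_dense {M : pseudoMetricType R} (A : set M) :
  porous A -> dense (~` closure A).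
Proof.
move=> [l0 [r0 [l00 _ r00 Ap]]] O [x Ox] Oo.
have /nbhs_ballP[r /= r_gt0 xrO] := open_nbhs_nbhs (conj Oo Ox).
have m0 : 0 < Num.min r r0 by rewrite lt_min r_gt0.
have [|y yA] := Ap x (Num.min r r0) m0; first by rewrite ge_min lexx orbT.
have lm0 : 0 < l0 * Num.min r r0 by rewrite mulr_gt0.
exists y; split.
  have [+ _] := yA y (ballxx y lm0); move/(@le_ball _ _ x _ r) => xy.
  by apply/xrO/xy; rewrite ge_min lexx.
move=> /(_ _ (nbhsx_ballx y _ lm0))[z [Az]] /yA[].
by move=> _ /(_ Az).
Qed.

Lemma sigma_porous_dense {V : completeNormedModType R} (A : set V) :
  sigma_porous A -> dense (~` A).
Proof.
move=> [P Pp ->] O O0 Oo.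
have [|y [Oy Py]] := @Baire R V (fun n => ~` closure (P n)) _ O O0 Oo.
  move=> n; split; last exact: porous_nowhere_dense.
  exact/closed_openC/closed_closure.
exists y; split=> // -[n _ Pny].
by apply: (Py n I); exact: subset_closure.
Qed.

End PorousSets.

(** * Creating peaks by small perturbations *)

Section Perturbation.
Context {R : realType} {K : metricType R} {Y Z : normedModType R}.
Variables (J : {linear Z -> (K -> Y)}) (gammaP : (Z -> R) -> (Z -> R) -> R).
Hypothesis J_Cb : forall g : Z, Cb (J g).
Hypothesis J_norm : forall g : Z, sup_norm (J g) <= `|g|.
Hypothesis gammaPE : forall (x x' : K) (ys zs : Y -> R),
  dual_sphere Y ys -> dual_sphere Y zs ->
  gammaP (eval_functional J ys x) (eval_functional J zs x') = mdist x x'.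
Variable x0 : K.
Hypothesis dual0 : dual_sphere Y !=set0.
Hypothesis separation : weakstar_uniform_separation (eval_functionals J) gammaP.

Lemma norm_eval_le g x : `|J g x| <= `|g|.
Proof.
by apply: le_trans (J_norm g); apply: norm_le_sup_norm; case: (J_Cb g).
Qed.

Lemma bounded_funD_eval (f : K -> Y) g : bounded_fun f -> bounded_fun (f + J g).
Proof.
move=> fb; exists (sup_norm f + `|g|); split; first exact: num_real.
move=> M /ltW fM z _ /=; apply: le_trans fM.
apply: le_trans (ler_normD _ _) _.
by rewrite lerD ?norm_le_sup_norm ?norm_eval_le.
Qed.

(** The separation property bounds each [zs (J t z)]; choosing for each [z] a
    functional [zs] that norms [J t z] turns this into a bound on the norm.
    Capping [w] at [1] lets it serve as a ratio of radii. *)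
Lemma separating_bump e : 0 < e -> exists w : R, [/\ 0 < w, w <= 1 &
  forall x ys, dual_sphere Y ys -> exists2 t : Z, `|t| <= 1 &
    forall z, e <= mdist z x -> `|J t z| <= ys (J t x) - w].
Proof.
move=> e0; have [a a0 sepa] := separation.
have [||w w0 sepw] := sepa (Num.min e a); first by rewrite lt_min e0.
  by rewrite ge_min lexx orbT.
exists (Num.min w 1); split; first by rewrite lt_min w0 /=.
  by rewrite ge_min lexx orbT.
move=> x ys yS; have [|t t1 tsep] := sepw (eval_functional J ys x).
  by exists x, ys.
exists t => // z ez.
have [zs zS <-] := dual_sphere_norming (J t z) dual0.
have wm : Num.min w 1 <= w by rewrite ge_min lexx.
have := tsep (eval_functional J zs z).
rewrite gammaPE// /eval_functional => /(_ _ _)/le_trans; apply.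
- by exists z, zs.
- by rewrite ge_min ez.
- by rewrite lerB.
Qed.

(** The value at [x] is below the supremum by at most [s * w / 4], the bump gains
    [s * w] over the far points, and [v] costs [s * w / 8] on each side: the far
    values stay at least [s * w / 2] below the value at [x]. *)
Lemma peak_bump e : 0 < e -> exists w : R, [/\ 0 < w, w <= 1 &
  forall (f : K -> Y) x s, bounded_fun f -> 0 < s ->
    sup_norm f - s * w / 4 < `|f x| ->
    exists2 t : Z, `|t| <= 1 &
      forall v : Z, `|v| <= s * w / 8 -> peak (f + J (s *: t + v)) e x].
Proof.
move=> e0; have [w [w0 w1 sepw]] := separating_bump e e0.
exists w; split=> // f x s fb s0 fx.
have [ys yS yfx] := dual_sphere_norming (f x) dual0.
have [t t1 tsep] := sepw x ys yS.
exists t => // v vw.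
have sw0 : 0 < s * w by rewrite mulr_gt0.
pose g := f + J (s *: t + v).
have gE z : g z = (f z + s *: J t z) + J v z.
  by rewrite /g linearD linearZ /= addrA.
have gb : bounded_fun g by exact: bounded_funD_eval.
have ysx : `|f x| + s * ys (J t x) <= `|f x + s *: J t x|.
  apply: le_trans (dual_sphere_le ys _ yS).
  have [[/= plin _] _] := yS.
  have := plin s (J t x) (f x).
  by rewrite [X in ys X]addrC => ->; rewrite yfx addrC.
have vx z : `|J v z| <= s * w / 8 by exact: le_trans (norm_eval_le v z) vw.
exists (s * w / 2); first by lra.
move=> z gz; rewrite ltNge; apply/negP => /tsep tz.
have gxle := norm_le_sup_norm g x gb.
have fz := norm_le_sup_norm f z fb.
have gz_le : `|g z| <= `|f z| + s * `|J t z| + `|J v z|.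
  rewrite gE (le_trans (ler_normD _ _))// lerD2r (le_trans (ler_normD _ _))//.
  by rewrite normrZ gtr0_norm.
have gx_ge : `|f x + s *: J t x| - `|J v x| <= `|g x|.
  have := ler_normB (f x + s *: J t x + J v x) (J v x).
  by rewrite addrK gE; lra.
have stz : s * `|J t z| <= s * ys (J t x) - s * w by rewrite -mulrBr ler_pM2l.
move: gz; rewrite -/g; have := vx x; have := vx z; lra.
Qed.

(** Half of the radius [r] is spent on the bump and [w / 16 * r], which is
    [s * w / 8] for [s = r / 2], on the ball around it. *)
Lemma no_peak_porous h e : bounded_fun h -> 0 < e ->
  porous [set g : Z | forall x, ~ peak (h + J g) e x].
Proof.
move=> hb e0; have [w [w0 w1 bump]] := peak_bump e e0.
have w16 : 0 < w / 16 by lra.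
exists (w / 16), 1; split=> //; first by lra.
move=> g r r0 _.
have rw : 0 < r * w by rewrite mulr_gt0.
have rw_le : r * w <= r by rewrite ger_pMr.
have rw4 : 0 < r / 2 * w / 4 by lra.
have [x hgx] := near_sup_norm x0 (h + J g) _ (bounded_funD_eval h g hb) rw4.
have r2 : 0 < r / 2 by lra.
have [t t1 tp] := bump (h + J g) x (r / 2) (bounded_funD_eval h g hb) r2 hgx.
exists (g + (r / 2) *: t) => g'; rewrite -!ball_normE/= => g'y.
have tr : `|(r / 2) *: t| <= r / 2.
  by rewrite normrZ gtr0_norm// ger_pMr.
split.
  have -> : g - g' = g + (r / 2) *: t - g' - (r / 2) *: t.
    by rewrite [in RHS]addrAC addrK.
  apply: le_lt_trans (ler_normB _ _) _; lra.
move=> /(_ x); apply.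
have := tp (g' - (g + (r / 2) *: t)).
rewrite distrC.
have -> : h + J g + J (r / 2 *: t + (g' - (g + r / 2 *: t))) = h + J g'.
  by rewrite -addrA -linearD; congr (h + J _); rewrite addrA addrC subrK.
by apply; lra.
Qed.

(** Intersecting the sets without peak of radius [1 / (n + 1)] with the set itself
    makes the union equal to it. *)
Lemma not_strongly_attaining_sigma_porous (h : K -> Y) :
  complete_metric K -> Cb h -> sigma_porous (not_strongly_attaining J h).
Proof.
move=> Kc [hc hb].
exists (fun n => not_strongly_attaining J h `&`
    [set g : Z | forall x, ~ peak (h + J g) n.+1%:R^-1 x]) => [n|].
  apply: porousS (no_peak_porous h n.+1%:R^-1 hb _); first exact: subIsetr.
  by rewrite invr_gt0.
apply/seteqP; split=> [g gN|g [n _ []]//].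
apply: contrapT => npk; apply: (gN); apply: strongly_attains_of_peaks => //.
  split; last exact: bounded_funD_eval.
  by move=> x; apply: cvgD; [exact: hc|exact: (J_Cb g).1].
move=> n; apply: contrapT => /forallNP np; apply: npk.
by exists n.
Qed.

End Perturbation.

(** * Genericity and the quantitative perturbation *)

Theorem theorem3 (R : realType) (K : metricType R)
    (Y Z : completeNormedModType R)
    (K_complete : complete_metric K)
    (J : {linear Z -> (K -> Y)})
    (J_inj : injective J)
    (J_Cb : forall g : Z, Cb (J g))
    (J_norm : forall g : Z, sup_norm (J g) <= `|g|)
    (eval_inj : forall (x1 x2 : K) (y1 y2 : Y -> R),
       dual_sphere Y y1 -> dual_sphere Y y2 ->
       eval_functional J y1 x1 = eval_functional J y2 x2 ->
       x1 = x2 /\ y1 = y2)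
    (gammaP : (Z -> R) -> (Z -> R) -> R)
    (gammaPE : forall (x x' : K) (ys zs : Y -> R),
       dual_sphere Y ys -> dual_sphere Y zs ->
       gammaP (eval_functional J ys x) (eval_functional J zs x') = mdist x x')
    (CK_complete : complete_pseudometric_on (eval_functionals J) gammaP)
    (CK_separation :
       weakstar_uniform_separation (eval_functionals J) gammaP) :
  (forall h : K -> Y, Cb h -> sigma_porous (not_strongly_attaining J h)) /\
  (forall e : R, 0 < e ->
     exists2 lambda : R, 0 < lambda &
       forall f : Z, sup_norm (J f) = 1 ->
       forall x : K, 1 - lambda < `|J f x| ->
         exists (k : Z) (xbar : K),
           [/\ sup_norm (J k) = 1,
               strongly_attains_at (J k) xbar,
               mdist xbar x < e &
               sup_norm (J f - J k) < e]).
Proof.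
have [[[_ [x0 [ys0 [ys0S _]]]] _ _ _ _] _] := CK_complete.
have dual0 : dual_sphere Y !=set0 by exists ys0.
have sporous h : Cb h -> sigma_porous (not_strongly_attaining J h).
  exact: (not_strongly_attaining_sigma_porous J gammaP J_Cb J_norm gammaPE x0).
split=> // e e0.
have [w [w0 w1 bump]] :=
  peak_bump J gammaP J_Cb J_norm gammaPE dual0 CK_separation e e0.
(* The final error is [4 * s]: [2 * s] from the perturbation and as much from
   the normalisation, whose divisor [m] then stays above [1 / 2]. *)
have [s [s0 se s1]] : exists s : R, [/\ 0 < s, 8 * s <= e & 8 * s <= 1].
  exists (Num.min e 1 / 8); rewrite [8 * _]mulrC divfK ?pnatr_eq0//.
  by split; [rewrite divr_gt0// lt_min e0 /=|rewrite ge_min lexx|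
    rewrite ge_min lexx orbT].
have sw : s * w <= s by rewrite ger_pMr.
have sw0 : 0 < s * w by rewrite mulr_gt0.
exists (s * w / 4) => [|f f1 x fx]; first by lra.
have Jb g : bounded_fun (J g) by case: (J_Cb g).
have [|t t1 tpeak] := bump (J f) x s (Jb f) s0; first by rewrite f1.
have C0 : Cb (0 : K -> Y).
  split; first by move=> z; exact: cvg_cst.
  by exists 0; split=> // M M0 z _; rewrite /= normr0 ltW.
have sw8 : 0 < s * w / 8 by lra.
have bo : open (ball (f + s *: t) (s * w / 8)) by exact: ball_open.
(* The functions [0 + J g] are those of [Z] themselves. *)
have [|u [uball uN]] := sigma_porous_dense _ (sporous 0 C0) _ _ bo.
  by exists (f + s *: t); exact: ballxx.
have [xm] : strongly_attains (J u) by apply: contrapT; rewrite -[J u]add0r.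
move=> uxm.
move: uball; rewrite -ball_normE/= => uball.
have upeak : peak (J u) e x.
  have := tpeak (u - (f + s *: t)); rewrite distrC => /(_ (ltW uball)).
  by rewrite -linearD addrA addrC subrK.
have fu : `|f - u| <= 2 * s.
  have -> : f - u = f + s *: t - u - s *: t.
    by rewrite [in RHS]addrAC addrK.
  have : `|s *: t| <= s by rewrite normrZ gtr0_norm// ger_pMr.
  by have := ler_normB (f + s *: t - u) (s *: t); lra.
have fuz z : `|J f z - J u z| <= 2 * s.
  apply: le_trans fu; have := norm_eval_le J J_Cb J_norm (f - u) z.
  by rewrite linearB.
set m := sup_norm (J u).
have mle : m <= 1 + 2 * s.
  apply: (sup_norm_le x0) => z.
  have := norm_le_sup_norm (J f) z (Jb f); rewrite f1.
  have := ler_distD (J f z) (J u z) 0; rewrite !subr0 distrC.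
  by have := fuz z; lra.
have mge : 1 - 2 * s <= m.
  rewrite lerBlDr -[leLHS]f1; apply: (sup_norm_le x0) => z.
  have := norm_le_sup_norm (J u) z (Jb u); rewrite -/m.
  have := ler_distD (J u z) (J f z) 0; rewrite !subr0.
  by have := fuz z; lra.
have m0 : 0 < m by lra.
have mV0 : 0 < m^-1 by rewrite invr_gt0.
have kE : J (m^-1 *: u) = m^-1 *: J u by rewrite linearZ.
exists (m^-1 *: u), xm; split.
- by rewrite kE (sup_normZ x0)// mulVf// gt_eqF.
- by rewrite kE; exact: strongly_attains_atZ.
- exact: strongly_attains_peak upeak uxm.
- suff : sup_norm (J f - J (m^-1 *: u)) <= 4 * s by lra.
  apply: (sup_norm_le x0) => z.
  have -> : (J f - J (m^-1 *: u)) z = (J f z - J u z) + (1 - m^-1) *: J u z.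
    by rewrite kE scalerBl scale1r addrA subrK.
  have mm : `|(1 - m^-1) *: J u z| <= `|m - 1|.
    have -> : 1 - m^-1 = (m - 1) * m^-1 by rewrite mulrBl divff ?gt_eqF// mul1r.
    rewrite normrZ normrM (gtr0_norm mV0) -mulrA ler_piMr// ler_pdivrMl// mulr1.
    exact: norm_le_sup_norm.
  have m12 : `|m - 1| <= 2 * s by rewrite ler_norml; lra.
  by have := ler_normD (J f z - J u z) ((1 - m^-1) *: J u z); have := fuz z; lra.
Qed.
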